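(* Let $0<T<\infty$, let $L\ge1$ be an integer, and let $$M(t)=\sum_{\ell=1}^L a_\ell e^{-\mu_\ell t},\qquad \mu_\ell>0,\quad \mu_\ell\ne\mu_{\ell'}\ (\ell\ne\ell'),\quad a_\ell\in\mathbb C\setminus\{0\}.$$ Then: (i) the modal data $\{(\mu_\ell,a_\ell)\}_{\ell=1}^L$ are uniquely determined by the derivatives $\{M^{(n)}(0)\}_{n=0}^{2L-1}$; (ii) for any $h\in(0,T/(2L-1)]$, the modal data $\{(\mu_\ell,a_\ell)\}_{\ell=1}^L$ are uniquely determined by the samples $\{M(0),M(h),\dots,M((2L-1)h)\}$. Here ''uniquely determined'' means: if $\widetilde M(t)=\sum_{\ell=1}^L\tilde a_\ell e^{-\tilde\mu_\ell t}$ is another function of the same form (same $L$, pairwise distinct $\tilde\mu_\ell>0$, $\tilde a_\ell\ne0$) having the same values of the listed data as $M$, then $\{(\tilde\mu_\ell,\tilde a_\ell)\}_{\ell=1}^L=\{(\mu_\ell,a_\ell)\}_{\ell=1}^L$ as sets.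
   Context: $M^{(n)}(0)$ denotes the $n$-th derivative of $M$ at $0$. The number $L$ of modes is regarded as known. *)

(* Defs.v *)
From HB Require Import structures.
From mathcomp Require Import all_boot all_order all_algebra.
From mathcomp Require Import complex.
From mathcomp Require Import all_classical all_reals all_analysis.
Import Order.TTheory GRing.Theory Num.Theory.
Import numFieldNormedType.Exports.

Set Implicit Arguments.
Unset Strict Implicit.
Unset Printing Implicit Defensive.

Local Open Scope classical_set_scope.
Local Open Scope ring_scope.
Local Open Scope complex_scope.

(* The alias [Rcomplex R] of [R[i]] already carries the R-module structure and
   the R-valued modulus; with the topology of the modulus it is a normed module
   over R, so that [derive1n] applies to complex-valued functions of a real
   variable. *)
Lemma normr_Rcomplex_scale (R : realType) (k : R) (z : Rcomplex R) :
  `|k *: z| = `|k| * `|z|.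
Proof.
case: z => x y; rewrite /Num.norm /=.
by rewrite !exprMn -mulrDr sqrtrM ?sqr_ge0// sqrtr_sqr.
Qed.

HB.instance Definition _ (R : realType) :=
  PseudoMetric.copy (Rcomplex R) (pseudoMetric_normed (Rcomplex R)).
HB.instance Definition _ (R : realType) := isPointed.Build (Rcomplex R) 0.
HB.instance Definition _ (R : realType) :=
  NormedZmod_PseudoMetric_eq.Build R (Rcomplex R) erefl.
HB.instance Definition _ (R : realType) :=
  PseudoMetricNormedZmod_Lmodule_isNormedModule.Build R (Rcomplex R)
    (@normr_Rcomplex_scale R).

Definition admissible_modes (R : realType) (L : nat)
    (mu : 'I_L -> R) (a : 'I_L -> R[i]) : Prop :=
  [/\ forall l, 0 < mu l, injective mu & forall l, a l != 0].

Definition modal_sum (R : realType) (L : nat)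
    (mu : 'I_L -> R) (a : 'I_L -> R[i]) (t : R) : Rcomplex R :=
  \sum_(l < L) a l * (expR (- mu l * t))%:C.

Definition modal_data (R : realType) (L : nat)
    (mu : 'I_L -> R) (a : 'I_L -> R[i]) : set (R * R[i]) :=
  range (fun l => (mu l, a l)).

(* Main.v *)
(* Both kinds of data are the moments [\sum_l a l * g (mu l) ^+ n], n < 2L, of
   the weights [a] at the nodes [g (mu l)], with [g m = - m] for derivatives and
   [g m = exp (- m h)] for samples; both [g] are injective.  Equal moments pair
   equally with every polynomial of degree < 2L, and the two families have at
   most 2L nodes together, so a polynomial of degree < 2L can vanish at all nodes
   but one and thereby read off the weight there. *)
Require Import Defs.
From mathcomp Require Import all_boot all_order all_algebra.
From mathcomp Require Import complex.
From mathcomp Require Import all_classical all_reals all_analysis.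
Import Order.TTheory GRing.Theory Num.Theory.
Import numFieldNormedType.Exports.

Local Open Scope classical_set_scope.
Local Open Scope ring_scope.
Local Open Scope complex_scope.

(** Both sides are linear in [p], and the hypothesis is the case of the monomials of degree below
    [N]. *)
Lemma eq_moments_horner {F : comNzRingType} {I J : finType} (N : nat)
    (x a : I -> F) (y b : J -> F) :
  (forall n, (n < N)%N ->
     \sum_i a i * x i ^+ n = \sum_j b j * y j ^+ n) ->
  forall p : {poly F}, (size p <= N)%N ->
  \sum_i a i * p.[x i] = \sum_j b j * p.[y j].
Proof.
move=> eq_ab p sp.
have moments (K : finType) (c z : K -> F) :
    \sum_k c k * p.[z k] = \sum_(n < N) p`_n * \sum_k c k * z k ^+ n.
  under [RHS]eq_bigr do rewrite mulr_sumr.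
  rewrite exchange_big; apply: eq_bigr => k _.
  rewrite (horner_coef_wide _ sp) mulr_sumr.
  by apply: eq_bigr => n _; rewrite mulrCA.
by rewrite !moments; apply: eq_bigr => n _; rewrite eq_ab.
Qed.

Lemma eq_moments_atom {F : idomainType} {I J : finType}
    (x a : I -> F) (y b : J -> F) :
  injective x -> injective y -> (forall i, a i != 0) ->
  (forall n, (n < #|I| + #|J|)%N ->
     \sum_i a i * x i ^+ n = \sum_j b j * y j ^+ n) ->
  forall i, exists2 j, y j = x i & b j = a i.
Proof.
move=> x_inj y_inj a_neq0 eq_ab i.
(* [p] vanishes at every node except [x i], so pairing it with both families
   isolates the weights they give to [x i]. *)
pose s := [seq z <- codom x ++ codom y | z != x i].
pose p := \prod_(z <- s) ('X - z%:P).
have rootp z : z \in codom x ++ codom y -> root p z = (z != x i).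
  by move=> zs; rewrite root_prod_XsubC mem_filter zs andbT.
(* [p] has size one more than the number of its listed roots; the filter drops at least the entry
   [x i], which absorbs this one. *)
have sp : (size p <= #|I| + #|J|)%N.
  rewrite size_prod_XsubC -(size_codom x) -(size_codom y) -size_cat.
  rewrite size_filter ltn_neqAle count_size andbT -all_count.
  apply/allPn; exists (x i); last by rewrite negbK.
  by rewrite mem_cat codom_f.
have px_neq0 : p.[x i] != 0.
  by rewrite -/(root p _) rootp ?eqxx// mem_cat codom_f.
have := eq_moments_horner _ _ _ _ _ eq_ab _ sp.
rewrite (bigD1 i)//= [X in _ + X]big1 ?addr0; last first.
  move=> k k_neq_i; have /rootP-> : root p (x k).
    by rewrite rootp ?mem_cat ?codom_f// (inj_eq x_inj).
  by rewrite mulr0.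
have py0 j : y j != x i -> p.[y j] = 0.
  by move=> ?; apply/rootP; rewrite rootp// mem_cat codom_f orbT.
(* If [x i] is a node [y j], both sums reduce to one term and [p.[x i]] cancels. Otherwise the right
   sum is 0, against [a i * p.[x i] != 0]. *)
have [[j yjx]|no_j] := pselect (exists j, y j = x i).
  rewrite (bigD1 j)//= [X in _ + X]big1 ?addr0 => [|k k_neq_j].
    by rewrite yjx => /(mulIf px_neq0) ->; exists j.
  by rewrite py0 ?mulr0// -yjx (inj_eq y_inj).
rewrite [RHS]big1 => [/eqP|j _].
  by rewrite mulf_eq0 (negPf (a_neq0 i)) (negPf px_neq0).
by rewrite py0 ?mulr0//; apply/eqP => ?; apply: no_j; exists j.
Qed.

(** The difference quotient is that of [f] times the fixed vector [v], and scaling [v] is continuous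
    in the scalar. This reduces each complex mode to a real exponential. *)
Lemma is_derive_scalel {R : numFieldType} {V : normedModType R}
    (f : R -> R) (x df : R) (v : V) :
  is_derive x 1 f df -> is_derive x 1 (fun t => f t *: v) (df *: v).
Proof.
move=> [f_drv f_val].
have cvg_fv : (h^-1 *: (f (h *: 1 + x) *: v - f x *: v)) @[h --> 0^'] -->
    df *: v.
  under eq_fun do rewrite -scalerBl scalerA.
  by apply: cvgZr_tmp; rewrite -f_val; exact: f_drv.
by split; [apply/cvg_ex; exists (df *: v) | exact: cvg_lim].
Qed.

Section ModalSum.
Context {R : realType} {L : nat}.
Implicit Types (mu : 'I_L -> R) (a : 'I_L -> R[i]).

Lemma Rcomplex_scaleE (k : R) (z : R[i]) :
  k *: (z : Rcomplex R) = z * k%:C.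
Proof. by case: z => u v; simpc; congr (_ +i* _); rewrite mulrC. Qed.

Lemma derive1_modal_sum mu a :
  derive1 (modal_sum mu a) = modal_sum mu (fun l => a l * (- mu l)%:C).
Proof.
apply/funext => t; rewrite derive1E.
have -> : modal_sum mu a =
    \sum_(l < L) fun s => expR (- mu l * s) *: (a l : Rcomplex R).
  apply/funext => s; rewrite fct_sumE.
  by apply: eq_bigr => l _; rewrite Rcomplex_scaleE.
have drv l : is_derive t 1 (fun s => expR (- mu l * s) *: (a l : Rcomplex R))
    ((- mu l * expR (- mu l * t)) *: (a l : Rcomplex R)).
  apply: is_derive_scalel.
  by apply: is_derive_eq; rewrite /GRing.scale/= mulr1 mulrC.
have sum_drv := is_derive_sum drv.
rewrite derive_val; apply: eq_bigr => l _.
by rewrite Rcomplex_scaleE rmorphM mulrA.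
Qed.

Lemma derive1n_modal_sum0 n mu a :
  derive1n n (modal_sum mu a) 0 = \sum_l a l * (- mu l)%:C ^+ n.
Proof.
(* The induction needs the identity as functions, not just at 0: each derivative is again a modal
   sum, with only the weights changed. *)
have -> : derive1n n (modal_sum mu a) =
    modal_sum mu (fun l => a l * (- mu l)%:C ^+ n).
  elim: n => [|n IHn].
    by rewrite derive1n0; congr modal_sum; apply/funext => l; rewrite mulr1.
  rewrite derive1nS IHn derive1_modal_sum.
  by congr modal_sum; apply/funext => l; rewrite exprSr mulrA.
by apply: eq_bigr => l _; rewrite mulr0 expR0 mulr1.
Qed.

Lemma modal_sum_natmul mu a k (h : R) :
  modal_sum mu a (k%:R * h) = \sum_l a l * (expR (- mu l * h))%:C ^+ k.
Proof.
apply: eq_bigr => l _.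
by rewrite -rmorphXn/= -expRM_natl mulrCA.
Qed.

(** Injectivity of [g] serves twice: it keeps the nodes [g (mu l)] distinct, and it recovers [mu l]
    from a node common to both families. *)
Lemma modal_data_sub (g : R -> R[i]) mu a mu' a' :
  injective g -> admissible_modes mu a -> admissible_modes mu' a' ->
  (forall n, (n <= 2 * L - 1)%N ->
     \sum_l a l * g (mu l) ^+ n = \sum_l a' l * g (mu' l) ^+ n) ->
  modal_data mu a `<=` modal_data mu' a'.
Proof.
move=> g_inj [_ mu_inj a_neq0] [_ mu'_inj _] eq_sums _ [l _ <-].
have [||||m /g_inj mu_m a_m] := eq_moments_atom (g \o mu) a (g \o mu') a' _ _ _ _ l.
- exact: inj_comp.
- exact: inj_comp.
- exact: a_neq0.
(* The subtraction in [2 * L - 1] is truncated, but [n < 2 * L] makes [2 * L] positive, so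
   [n <= 2 * L - 1]. *)
- move=> n; rewrite card_ord addnn -mul2n => n_lt; apply: eq_sums.
  by rewrite subn1 -ltnS (ltn_predK n_lt).
- by exists m; rewrite // mu_m a_m.
Qed.

Lemma modal_data_eq (g : R -> R[i]) mu a mu' a' :
  injective g -> admissible_modes mu a -> admissible_modes mu' a' ->
  (forall n, (n <= 2 * L - 1)%N ->
     \sum_l a l * g (mu l) ^+ n = \sum_l a' l * g (mu' l) ^+ n) ->
  modal_data mu a = modal_data mu' a'.
Proof.
move=> g_inj adm adm' eq_sums; apply/seteqP; split.
  exact: (modal_data_sub _ _ _ _ _ g_inj).
by apply: (modal_data_sub _ _ _ _ _ g_inj) => // n /eq_sums.
Qed.

End ModalSum.

Theorem theorem6p1 (R : realType) (T : R) (hT : 0 < T)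
    (L : nat) (hL : (1 <= L)%N) (mu : 'I_L -> R) (a : 'I_L -> R[i])
    (hM : admissible_modes mu a) :
  (forall (mu' : 'I_L -> R) (a' : 'I_L -> R[i]),
      admissible_modes mu' a' ->
      (forall n : nat, (n <= 2 * L - 1)%N ->
         derive1n n (modal_sum mu' a') 0 = derive1n n (modal_sum mu a) 0) ->
      modal_data mu' a' = modal_data mu a)
  /\
  (forall h : R, 0 < h <= T / (2 * L - 1)%N%:R ->
    forall (mu' : 'I_L -> R) (a' : 'I_L -> R[i]),
      admissible_modes mu' a' ->
      (forall k : nat, (k <= 2 * L - 1)%N ->
         modal_sum mu' a' (k%:R * h) = modal_sum mu a (k%:R * h)) ->
      modal_data mu' a' = modal_data mu a).
Proof.
split=> [mu' a' adm' eq_drv | h /andP[h_gt0 _] mu' a' adm' eq_smp].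
- apply: (modal_data_eq (fun m => (- m)%:C)) => //.
    by move=> m m' /complexI /oppr_inj.
  by move=> n /eq_drv; rewrite !derive1n_modal_sum0.
- apply: (modal_data_eq (fun m => (expR (- m * h))%:C)) => //.
    (* Since [h] is nonzero, [m * h] determines [m]. *)
    by move=> m m' /complexI /expR_inj /(mulIf (lt0r_neq0 h_gt0)) /oppr_inj.
  by move=> k /eq_smp; rewrite !modal_sum_natmul.
Qed.
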